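(* Let $N=\{1,\dots,n\}$ and let $\mathbf{d}=(d_1,\dots,d_n)$ be a sequence of nonnegative integers (not necessarily graphical). If $(\mathbf{x},\mathbf{e})$, with $\mathbf{e}=(e_1,\dots,e_n)$ real and $x_{ii}=0$ for all $i$, is an optimal solution of the integer program $$\begin{aligned}\min\;\;&\sum_i e_i\\ \text{s.t.}\;\;&\sum_{j\neq i}x_{ij}-d_i\le e_i && \forall\, i\\ & -\sum_{j\neq i}x_{ij}+d_i\le e_i && \forall\, i\\ & x_{ij}-x_{ji}=0 && \forall\, i<j\\ & x_{ij}\in\{0,1\} && \forall\, i\neq j,\end{aligned}$$ then the graph $\mathbf{x}$ is a closest graph to the degree sequence $\mathbf{d}$ in the $\ell_1$-norm, i.e. $$\|\eta(\mathbf{x})-\mathbf{d}\|_1=\min_{\mathbf{x}'\in X}\|\eta(\mathbf{x}')-\mathbf{d}\|_1 .$$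
   Context: $X$ denotes the set of all simple undirected graphs on $N=\{1,\dots,n\}$, each identified with its symmetric adjacency matrix $\mathbf{x}=(x_{ij})\in\{0,1\}^{n\times n}$ with $x_{ii}=0$ for all $i$. For $\mathbf{x}\in X$, $\eta(\mathbf{x})=(\eta_1(\mathbf{x}),\dots,\eta_n(\mathbf{x}))$ with $\eta_i(\mathbf{x})=\sum_j x_{ij}$ is its degree sequence (not sorted), and $\|\mathbf{d}-\mathbf{k}\|_1=\sum_{i=1}^n|d_i-k_i|$. *)

(* Defs.v *)
From HB Require Import structures.
From mathcomp Require Import all_boot all_order all_algebra.
From mathcomp Require Import classical_sets reals.

Set Implicit Arguments.
Unset Strict Implicit.
Unset Printing Implicit Defensive.

Import Order.TTheory GRing.Theory Num.Theory.
Local Open Scope ring_scope.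
Local Open Scope classical_set_scope.

(** Adjacency matrices have entries in [R], with integrality imposed as a
    constraint, so that they can be compared directly with the real variables
    [e i] of the program. *)

Definition graphs (R : realType) (n : nat) : set 'M[R]_n :=
  [set x : 'M[R]_n | [/\ forall i j, x i j = 0 \/ x i j = 1,
                         forall i j, x i j = x j i
                       & forall i, x i i = 0]].

Definition degree_seq (R : realType) (n : nat) (x : 'M[R]_n) : 'I_n -> R :=
  fun i => \sum_j x i j.

Definition l1_dist (R : realType) (n : nat) (d k : 'I_n -> R) : R :=
  \sum_i `|d i - k i|.

Definition is_minimum (R : realType) (A : set R) (m : R) : Prop :=
  A m /\ lbound A m.

(** The program has no diagonal variables; the first clause encodes this
    convention for a full matrix [x]. *)
Definition feasible (R : realType) (n : nat) (d : 'I_n -> nat)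
    (x : 'M[R]_n) (e : 'I_n -> R) : Prop :=
  (forall i, x i i = 0) /\
  [/\ forall i, (\sum_(j | j != i) x i j) - (d i)%:R <= e i,
      forall i, - (\sum_(j | j != i) x i j) + (d i)%:R <= e i,
      forall i j : 'I_n, (i < j)%N -> x i j - x j i = 0
    & forall i j, i != j -> x i j = 0 \/ x i j = 1].

Definition optimal_solution (R : realType) (n : nat) (d : 'I_n -> nat)
    (x : 'M[R]_n) (e : 'I_n -> R) : Prop :=
  feasible d x e /\
  forall (x' : 'M[R]_n) (e' : 'I_n -> R),
    feasible d x' e' -> \sum_i e i <= \sum_i e' i.

Definition closest_graph (R : realType) (n : nat) (d : 'I_n -> nat)
    (x : 'M[R]_n) : Prop :=
  let dist (y : 'M[R]_n) := l1_dist (degree_seq y) (fun i => (d i)%:R) in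
  @graphs R n x /\ is_minimum [set dist x' | x' in @graphs R n] (dist x).

(* Main.v *)
Require Import Defs.
From mathcomp Require Import all_boot all_order all_algebra.
From mathcomp Require Import classical_sets reals.

Set Implicit Arguments.
Unset Strict Implicit.
Unset Printing Implicit Defensive.

Import Order.TTheory GRing.Theory Num.Theory.
Local Open Scope ring_scope.

(** The two inequality constraints say [|eta_i(x) - d_i| <= e_i], so the cost
    of a feasible [(x, e)] is at least the distance from [x] to [d], with
    equality for [e_i = |eta_i(x) - d_i|]. *)

(** Minimising over [e] for a fixed graph thus leaves its distance to [d], so an optimal [x]
    minimises that distance over all graphs. [feasibleP] carries the argument. *)

Lemma degree_seq_off_diagonal (R : realType) (n : nat) (x : 'M[R]_n) (i : 'I_n) :
  x i i = 0 -> degree_seq x i = \sum_(j | j != i) x i j.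
Proof. by move=> xii; rewrite /degree_seq (bigD1 i) //= xii add0r. Qed.

Lemma feasibleP (R : realType) (n : nat) (d : 'I_n -> nat) (x : 'M[R]_n)
    (e : 'I_n -> R) :
  feasible d x e <->
  graphs x /\ forall i, `|degree_seq x i - (d i)%:R| <= e i.
Proof.
split.
- case=> x0 [le1 le2 sym bin]; split.
  + split=> // i j; first by have [->|/bin//] := eqVneq i j; left.
    (* The program imposes symmetry only for [i < j]; the case [j < i] follows by exchanging the
       indices. *)
    case: (ltngtP i j) => [ij|ji|/val_inj -> //].
    * exact/subr0_eq/sym.
    * exact/esym/subr0_eq/sym.
  + move=> i; rewrite degree_seq_off_diagonal // ler_norml le1 andbT.
    by rewrite lerNl opprB addrC le2.
- case=> -[bin sym x0] le_e; split=> //.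
  split=> [i|i|i j _|i j _]; last exact: bin.
  + rewrite -degree_seq_off_diagonal //.
    exact: le_trans (ler_norm _) (le_e i).
  + rewrite -degree_seq_off_diagonal // addrC.
    by apply: le_trans (ler_norm _) _; rewrite distrC.
  + by rewrite sym subrr.
Qed.

Theorem theorem6p11 (R : realType) (n : nat) (d : 'I_n -> nat)
    (x : 'M[R]_n) (e : 'I_n -> R) (hopt : optimal_solution d x e) :
  closest_graph d x.
Proof.
case: hopt => /feasibleP[gx le_e] opt.
split=> //; split; first by exists x.
move=> _ [y gy <-].
apply: (@le_trans _ _ (\sum_i e i)); first exact: ler_sum.
(* Unification with the goal picks for [e'] the deviations [|eta_i(y) - d_i|], the cheapest choice
   for [y]. *)
by apply: (opt y); apply/feasibleP.
Qed.
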